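(* Let $\sigma = (\sigma_r)_{r \geq 1}$ be an infinite increasing sequence of positive integers satisfying $\sigma_1 \geq 3$ and $\log \sigma_r \leq \sigma_{r-1}$ for all $r \geq 2$. If $G$ is an $n$-vertex graph with \[ \iota(G) \geq \sigma_1 \exp(8\log^*\! n), \] then $G$ contains a cycle whose length is equal to $\sigma_r$ for some $r$.
   Context: All graphs are finite and simple. For nonempty $X \subseteq V(G)$, $\alpha(X)$ is the independence number of the subgraph induced by $X$, and $\iota(G) := \sup_{\emptyset\neq X \subseteq V(G)} |X|/\alpha(X)$. $\log$ is the natural logarithm, and $\log^*\! n$ is the number of times the natural logarithm must be applied to $n$ to get a number less than one. *)

(* Defs.v *)
From HB Require Import structures.
From mathcomp Require Import all_boot all_order all_algebra.
From mathcomp Require Import classical_sets reals sequences exp.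

Set Implicit Arguments.
Unset Strict Implicit.
Unset Printing Implicit Defensive.

Import Order.TTheory GRing.Theory Num.Theory.
Local Open Scope ring_scope.

Section Graph.

(* A finite simple graph is a symmetric irreflexive [e : rel T] on [T : finType];
   the two properties are hypotheses of the theorem. *)
Variables (T : finType) (e : rel T).

Definition independent (S : {set T}) : bool :=
  [forall x in S, forall y in S, ~~ e x y].

(* Independent sets of the subgraph induced by X are exactly the independent
   sets of the whole graph that are contained in X. *)
Definition alpha (X : {set T}) : nat :=
  \max_(S : {set T} | (S \subset X) && independent S) #|S|.

Definition iota_ratio (R : realType) : R :=
  sup [set r : R | exists2 X : {set T},
         X != finset.set0 & r = #|X|%:R / (alpha X)%:R]%classic.

(* The vertices c_0, ..., c_(l-1) are pairwise distinct, consecutive ones are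
   adjacent, and so are c_(l-1) and c_0; the lower bound on l excludes single
   vertices and single edges traversed back and forth. *)
Definition has_cycle (l : nat) : Prop :=
  (2 < l)%N /\ exists c : seq T, size c = l /\ ucycle e c.

End Graph.

Section LogStar.

Variable R : realType.

Lemma iter_ln_lt1 (x : R) : exists k, iter k (@ln R) x < 1.
Proof.
have [m] : exists m : nat, x < m%:R by exists (Num.truncn x).+1; exact: truncnS_gt.
elim: m x => [|m IHm] x xm; first by exists 0%N; exact: lt_trans xm ltr01.
have [x1|x1] := ltP x 1; first by exists 0%N.
have lnx : ln x <= x - 1.
  have := @le_ln1Dx R (x - 1); rewrite (addrC 1) subrK; apply.
  by rewrite ltrBrDr addNr; exact: lt_le_trans ltr01 x1.
have [|k kP] := IHm (ln x); last by exists k.+1; rewrite iterSr.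
by apply: le_lt_trans lnx _; rewrite ltrBlDr natr1.
Qed.

(* The least k such that k applications of ln to x give a value < 1. All
   earlier iterates are >= 1, so the junk value of [ln] on nonpositive
   arguments plays no role. *)
Definition log_star (x : R) : nat := ex_minn (iter_ln_lt1 x).

End LogStar.

Arguments iota_ratio {T} e R.

(* Main.v *)
(* Breadth-first search from a vertex, stopped when the alternating unions
   V_i + V_(i-2) + ... of its layers stop growing by a factor of 10, splits the
   graph, at the cost of a factor 11 in the ratio |X| / alpha(X), into subsets
   of layers at depth less than k/2, where k is a forbidden cycle length. In a
   layer, a depth-first forest has only edges between ancestors and descendants.
   If two edges go up from the same vertex u by distinct even distances greater
   than k, they form with the tree path an odd cycle with a chord at u, and the
   paths in this graph have enough lengths for one of them, completed through
   the breadth-first tree, to give a cycle of length k. Otherwise the edges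
   going up by more than k can be removed by a 4-colouring, and the remaining
   graph has separators of size k, which cut it into pieces of size 8k at the
   cost of a factor 9/8. As 11 * 4 * 9/8 < e^4, a graph without cycles of length
   k and with at most 8 e^k vertices contains a set of at most 8k vertices whose
   ratio is smaller by a factor of at most e^4. Applying this with k = sigma_s,
   where s is minimal such that sigma_s >= log N, and then with
   k = sigma_(s-1) < log N, replaces N by log N at the cost of a factor e^8. *)

Require Import Defs.
From HB Require Import structures.
From mathcomp Require Import all_boot all_order all_algebra.
From mathcomp Require Import zify lra boolp.

Set Implicit Arguments.
Unset Strict Implicit.
Unset Printing Implicit Defensive.

Import Order.TTheory GRing.Theory Num.Theory.

(** * Paths of a fixed length in a cycle with a chord *)

Section Theta.

Variables D M : nat.

(* The cycle [0, 1, ..., D] with the chord [0, M]. *)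
Definition theta_adj : rel nat := fun a b =>
  [|| b == a.+1, a == b.+1,
      (a == 0) && ((b == D) || (b == M)) | (b == 0) && ((a == D) || (a == M))].

Lemma theta_up a n :
  path theta_adj a (iota a.+1 n) /\ last a (iota a.+1 n) = a + n.
Proof.
elim: n a => [|n IHn] a /=; first by rewrite addn0.
have [-> ->] := IHn a.+1; rewrite /theta_adj eqxx /=; split=> //; lia.
Qed.

Lemma theta_down a n : n <= a ->
  path theta_adj a (rev (iota (a - n) n)) /\
  last a (rev (iota (a - n) n)) = a - n.
Proof.
elim: n => [|n IHn] na /=; first by rewrite subn0.
have [|Pn Ln] := IHn; first lia.
rewrite rev_cons rcons_path last_rcons.
have -> : (a - n.+1).+1 = a - n by lia.
by rewrite Pn Ln; split=> //=; rewrite /theta_adj; lia.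
Qed.

Variables (d : nat) (chi : nat -> bool).
Hypotheses (d_gt0 : 0 < d) (dM : d <= M) (MD : M < D).
Hypothesis chi_path : forall x p, path theta_adj x p -> uniq (x :: p) ->
  all (fun a => a <= D) (x :: p) -> size p = d -> chi x = chi (last x p).

Lemma chi_shift t : t + d <= D -> chi t = chi (t + d).
Proof.
move=> tD; have [Pu Lu] := theta_up t d.
rewrite -Lu; apply: chi_path => //; last by rewrite size_iota.
- by rewrite /= iota_uniq mem_iota andbT; lia.
- apply/allP=> z; rewrite inE mem_iota; lia.
Qed.

(** The path goes down from [t] to 0, jumps to [J] and goes on down; given period [d], this makes
    [J + 1] a period. *)
Lemma chi_wrap J t : (J == D) || (J == M) -> t < d ->
  chi t = chi (J + t.+1 - d).
Proof.
move=> JDM td.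
have [|P1 L1] := @theta_down t t; first by [].
have [|P2 L2] := @theta_down J (d - t.+1); first lia.
rewrite subnn in P1 L1.
have -> : J + t.+1 - d =
    last t (rev (iota 0 t) ++ J :: rev (iota (J - (d - t.+1)) (d - t.+1))).
  rewrite last_cat /= L2; lia.
apply: chi_path.
- by rewrite cat_path P1 L1 /= P2 /theta_adj; lia.
- rewrite -cat_cons cat_uniq cons_uniq rev_uniq iota_uniq mem_rev mem_iota.
  rewrite cons_uniq rev_uniq iota_uniq mem_rev mem_iota.
  rewrite (_ : has _ _ = false) ?andbT; first lia.
  apply/negbTE/hasPn=> z; rewrite !inE !mem_rev !mem_iota; lia.
- apply/allP=> z; rewrite !(inE, mem_cat) !mem_rev !mem_iota; lia.
- rewrite size_cat /= !size_rev !size_iota; lia.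
Qed.

(** The path goes down from [t] to 0, crosses the chord and goes up from [M]; modulo the periods [d]
    and [M + 1] this is [z |-> - 2 - z]. *)
Lemma chi_reflect t : t < d -> M + d <= D + t.+1 ->
  chi t = chi (M + d - t.+1).
Proof.
move=> td tD.
have [|P1 L1] := @theta_down t t; first by [].
have [P2 L2] := theta_up M (d - t.+1).
rewrite subnn in P1 L1.
have -> : M + d - t.+1 = last t (rev (iota 0 t) ++ M :: iota M.+1 (d - t.+1)).
  rewrite last_cat /= L2; lia.
apply: chi_path.
- by rewrite cat_path P1 L1 /= P2 /theta_adj; lia.
- rewrite -cat_cons cat_uniq cons_uniq rev_uniq iota_uniq mem_rev mem_iota.
  rewrite cons_uniq iota_uniq mem_iota.
  rewrite (_ : has _ _ = false) ?andbT; first lia.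
  apply/negbTE/hasPn=> z; rewrite !inE !mem_rev !mem_iota; lia.
- apply/allP=> z; rewrite !(inE, mem_cat) !mem_rev !mem_iota; lia.
- rewrite size_cat /= !size_rev !size_iota; lia.
Qed.

(** The path goes up from [D - j] to [D], then through 0 to [M] and down; modulo [d], [M + 1] and
    [D + 1] it matches [- (j + 1)] with [j + 1]. *)
Lemma chi_reflect2 j : j.+2 <= d -> M + j < D ->
  chi (D - j) = chi (M + j.+2 - d).
Proof.
move=> jd jD.
have [P1 L1] := theta_up (D - j) j.
have [|P2 L2] := @theta_down M (d - j.+2); first lia.
have -> : M + j.+2 - d = last (D - j) (iota (D - j).+1 j ++
   0 :: M :: rev (iota (M - (d - j.+2)) (d - j.+2))).
  rewrite last_cat /= L2; lia.
apply: chi_path.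
- by rewrite cat_path P1 L1 /= P2 /theta_adj; lia.
- rewrite -cat_cons cat_uniq cons_uniq iota_uniq mem_iota.
  rewrite !cons_uniq rev_uniq iota_uniq inE !mem_rev !mem_iota.
  rewrite (_ : has _ _ = false) ?andbT; first lia.
  apply/negbTE/hasPn=> z; rewrite !inE !mem_rev !mem_iota; lia.
- apply/allP=> z; rewrite !(inE, mem_cat) !mem_rev !mem_iota; lia.
- rewrite size_cat /= !size_rev !size_iota; lia.
Qed.

End Theta.

(** * Periodic functions on the integers *)

Section Periodic.
Local Open Scope ring_scope.

Variable f : int -> bool.

Definition periodic (a : int) := forall z, f (z + a) = f z.

Lemma periodicN a : periodic a -> periodic (- a).
Proof. by move=> fa z; rewrite -(fa (z - a)) subrK. Qed.

Lemma periodicD a b : periodic a -> periodic b -> periodic (a + b).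
Proof. by move=> fa fb z; rewrite addrA fb fa. Qed.

Lemma periodicMn a m : periodic a -> periodic (a *~ m).
Proof.
move=> fa; have fn (n : nat) : periodic (a *~ n).
  elim: n => [|n IHn]; first by move=> z; rewrite mulr0z addr0.
  by rewrite -pmulrn mulrS pmulrn; apply: periodicD.
by case: m => n; [|rewrite NegzE mulrNz; apply: periodicN].
Qed.

(** Moving [z] by a multiple of [a] moves [b - z] by one too, so a window of one period suffices. *)
Lemma reflect_window (a b l : int) : 0 < a -> periodic a ->
  (forall z, l <= z < l + a -> f (b - z) = f z) -> forall z, f (b - z) = f z.
Proof.
move=> a0 fa flb z.
have az : ((z - l) %/ a)%Z * a + ((z - l) %% a)%Z = z - l by rewrite -divz_eq.
have r0 : 0 <= ((z - l) %% a)%Z by apply: modz_ge0; lia.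
have ra : ((z - l) %% a)%Z < a by apply: ltz_pmod.
set q := ((z - l) %/ a)%Z in az; set r := ((z - l) %% a)%Z in az r0 ra.
have fq : periodic (a *~ q) by exact: periodicMn.
rewrite (_ : z = (l + r) + a *~ q); last by rewrite -mulrzr intz mulrC; lia.
by rewrite fq opprD addrA (periodicN fq) flb //; lia.
Qed.

Lemma odd_period_constant (a : nat) : odd a -> periodic a%:Z -> periodic 2 ->
  forall z, f z = f 0.
Proof.
move=> oa fa f2.
have f1 : periodic 1%:Z.
  suff <- : a%:Z - 2%:Z *~ (a./2)%:Z = 1%:Z.
    by apply: periodicD => //; apply/periodicN/periodicMn.
  by have := odd_double_half a; rewrite oa -mulrzr intz; lia.
move=> z; have := periodicMn z f1 0.
by rewrite add0r -mulrzr mul1r intz.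
Qed.
End Periodic.

(** * Constancy on an odd cycle with a chord *)

Section ThetaConstant.
Local Open Scope ring_scope.

(* [chi] extends to the integers with periods [d], [D + 1] and [M + 1], and is
   then invariant under [z |-> - 2 - z] and [z |-> - z], hence under
   [z |-> z + 2]; as [D + 1] is odd, it has period 1. *)
Lemma theta_constant (D M d : nat) (chi : nat -> bool) :
  (0 < d)%N -> (d <= M)%N -> (M < D)%N -> ~~ odd D ->
  (forall x p, path (theta_adj D M) x p -> uniq (x :: p) ->
     all (fun a => a <= D)%N (x :: p) -> size p = d -> chi x = chi
       (last x p)) ->
  forall t, (t <= D)%N -> chi t = chi 0%N.
Proof.
move=> d0 dM MD evD H.
pose f (z : int) := chi `|(z %% d%:Z)%Z|%N.
have fd : periodic f d by move=> z; rewrite /f modzDr.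
have chif (t : nat) : (t <= D)%N -> chi t = f t.
  elim/ltn_ind: t => t IHt tD.
  have [td|dt] := ltnP t d; first by rewrite /f modz_small //; lia.
  have -> : t = (t - d + d)%N by lia.
  rewrite -(chi_shift d0 dM MD H); last lia.
  by rewrite IHt ?PoszD ?fd //; lia.
have fJ J : (J == D) || (J == M) -> periodic f J.+1%:Z.
  move=> JDM z.
  have zd0 : 0 <= (z %% d%:Z)%Z by apply: modz_ge0; lia.
  have zdd : (z %% d%:Z)%Z < d%:Z by apply: ltz_pmod; lia.
  have [t tz] : exists t : nat, (z %% d%:Z)%Z = t%:Z.
    by exists `|(z %% d%:Z)%Z|%N; lia.
  have zt : z = t%:Z + d%:Z *~ (z %/ d%:Z)%Z.
    by rewrite -tz -mulrzr intz mulrC {1}(divz_eq z d%:Z) addrC.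
  have fz := periodicMn (z %/ d%:Z)%Z fd.
  rewrite zt addrAC !fz.
  have td : (t < d)%N by lia.
  have tD : (t <= D)%N by lia.
  rewrite -(chif t tD) (chi_wrap d0 dM MD H JDM td) chif; last by lia.
  by rewrite -[in RHS](fd _); congr f; lia.
have fD : periodic f D.+1%:Z by apply: fJ; rewrite eqxx.
have fM : periodic f M.+1%:Z by apply: fJ; rewrite eqxx orbT.
have fm : periodic f (D - M)%N.
  have -> : (D - M)%N%:Z = D.+1%:Z - M.+1%:Z by lia.
  exact/periodicD/periodicN.
have refl0 (t : nat) : (t < d)%N -> (M + d <= D + t.+1)%N ->
    f (- 2 - t%:Z) = f t%:Z.
  move=> td tD; rewrite -chif; last lia.
  rewrite (chi_reflect d0 dM MD H td tD) chif; last lia.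
  by rewrite -(fM (-2 - _)) -[in LHS](fd _); congr f; lia.
have refl1 (j : nat) : (j.+2 <= d)%N -> (M + j < D)%N ->
    f (0 - (j.+1)%:Z) = f (j.+1)%:Z.
  move=> jd jD.
  have := chi_reflect2 d0 dM MD H jd jD.
  rewrite !chif; try lia.
  rewrite -(fD (0 - _)) => E.
  transitivity (f (D - j)%N); first by congr f; lia.
  by rewrite E -[in RHS](fM _) -[in LHS](fd _); congr f; lia.
(* The paths give each reflection on a window whose length is the smaller of [D - M] and [d]; both
   are periods. *)
have F0 : forall z, f (- 2 - z) = f z.
  have [md|dm] := ltnP (D - M) d.
    apply: (@reflect_window f (D - M)%N (-2) (d - (D - M).+1)%N) => //;
    first lia.
    by move=> [z|z] zl; [apply: refl0|]; lia.
  apply: (@reflect_window f d (-2) 0) => //.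
  by move=> [z|z] zl; [apply: refl0|]; lia.
have F1 : forall z, f (0 - z) = f z.
  have [md|dm] := ltnP (D - M) d.
    apply: (@reflect_window f (D - M)%N 0 1) => //; first lia.
    by move=> [[|z]|z] zl; [lia|apply: refl1|]; lia.
  apply: (@reflect_window f d 0 0) => //.
  by move=> [[|z]|z] zl; [by rewrite subr0|apply: refl1|]; lia.
have f2 : periodic f 2.
  by move=> z; rewrite -[RHS]F0 -(F1 (z + 2)); congr f; lia.
move=> t tD; rewrite !chif //.
by apply: (odd_period_constant _ fD f2); rewrite /= evD.
Qed.
End ThetaConstant.

(** * Cycles through a layer of a rooted tree *)

Section Layer.

Variables (T : finType) (e : rel T).
Hypothesis e_sym : symmetric e.

(* [P] lies at depth [i] in a tree with root [v], parent map [p] and depth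
   function [lev]. *)
Definition rooted_layer (P : {set T}) (i : nat) (p : T -> T) (lev : T -> nat)
    (v : T) :=
  forall u, u \in P -> [/\ iter i p u = v,
    forall j, j <= i -> lev (iter j p u) = i - j &
    forall j, j < i -> e (iter j p u) (iter j.+1 p u)].

Lemma climb_path (p : T -> T) u h :
  (forall j, j < h -> e (iter j p u) (iter j.+1 p u)) ->
  path e u (mkseq (fun j => iter j.+1 p u) h) /\
  last u (mkseq (fun j => iter j.+1 p u) h) = iter h p u.
Proof.
elim: h => [//|h IHh] eh.
have [|Ph Lh] := IHh; first by move=> j jh; apply: eh; lia.
by rewrite mkseqS rcons_path last_rcons Lh Ph /= (eh h).
Qed.

Lemma descend_path (p : T -> T) u h :
  (forall j, j < h -> e (iter j p u) (iter j.+1 p u)) ->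
  path e (iter h p u) (rev (mkseq (fun j => iter j p u) h)).
Proof.
elim: h => [//|h IHh] eh.
by rewrite mkseqS rev_rcons /= e_sym (eh h) // IHh // => j jh; apply: eh; lia.
Qed.

(** The cycle follows [q], climbs from its end to the common ancestor [h + 1] levels up and descends
    to [a]. Distinct ancestors at height [h] keep the two branches disjoint, and depth separates
    them from [q]. *)
Lemma branch_cycle P i p lev v (q : seq T) a h :
  rooted_layer P i p lev v -> h < i ->
  path e a q -> uniq (a :: q) -> {subset a :: q <= P} ->
  iter h.+1 p a = iter h.+1 p (last a q) ->
  iter h p a != iter h p (last a q) ->
  has_cycle e (size q + h.+1.*2).
Proof.
move=> PT hi pq uq qP eqh neqh.
set b := last a q in eqh neqh *.
have [aP bP] : a \in P /\ b \in P by split; apply: qP;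
  [exact: mem_head|exact: mem_last].
have [_ leva ea] := PT a aP; have [_ levb eb] := PT b bP.
pose U := mkseq (fun j => iter j.+1 p b) h.+1.
pose W := mkseq (fun j => iter j.+1 p a) h.
have [|PU LU] := @climb_path p b h.+1; first by move=> j jh; apply: eb; lia.
have PW := @descend_path p a h.+1.
have EW : rev (mkseq (fun j => iter j p a) h.+1) = rcons (rev W) a.
  by rewrite -rev_cons /W /mkseq /= -[1]addn0 iotaDl -map_comp.
rewrite EW eqh -LU in PW.
have lq : forall x, x \in a :: q -> lev x = i.
  by move=> x /qP xP; have [_ /(_ 0) -> //] := PT x xP; rewrite subn0.
have lU : forall j, j < h.+1 -> lev (iter j.+1 p b) = i - j.+1.
  by move=> j jh; apply: levb; lia.
have lW : forall j, j < h -> lev (iter j.+1 p a) = i - j.+1.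
  by move=> j jh; apply: leva; lia.
have UP x : x \in U -> exists2 j, j < h.+1 & x = iter j.+1 p b.
  by case/mapP=> j; rewrite mem_iota => ? ->; exists j.
have WP x : x \in W -> exists2 j, j < h & x = iter j.+1 p a.
  by case/mapP=> j; rewrite mem_iota => ? ->; exists j.
have q0 : 0 < size q by rewrite lt0n size_eq0; apply: contraNneq neqh;
  rewrite /b => ->.
split; first lia.
exists ((a :: q) ++ U ++ rev W); split.
  by rewrite !size_cat size_rev !size_mkseq /=; lia.
rewrite /ucycle; apply/andP; split.
  rewrite cat_cons /cycle !rcons_cat !cat_path pq PU; apply: PW => j jh.
  by apply: ea; lia.
rewrite !cat_uniq uq rev_uniq andTb; apply/and4P; split.
- apply/hasPn => x; rewrite mem_cat mem_rev => /orP[/UP|/WP] [j jh ->].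
    by apply/negP => /lq; rewrite lU //; lia.
  by apply/negP => /lq; rewrite lW //; lia.
- apply/mkseq_uniqP => j j' jh j'h /(congr1 lev).
  by rewrite !lU //; move: jh j'h; rewrite !inE; lia.
- apply/hasPn => x; rewrite mem_rev => /WP [j jh ->].
  apply/negP => /UP [j' j'h E].
  have := congr1 lev E; rewrite lU // lW // => ij.
  have {}ij : j' = j by lia.
  subst j'; move/eqP: neqh; apply.
  rewrite (_ : h = h - j.+1 + j.+1); last lia.
  by rewrite !iterD E.
- apply/mkseq_uniqP => j j' jh j'h /(congr1 lev).
  by rewrite !lW //; move: jh j'h; rewrite !inE; lia.
Qed.

(* Let [h] be minimal such that the vertices of the path have a common ancestor
   [h] levels up. By [theta_constant] some path of length [k - 2 * h] joins
   vertices in different branches below that ancestor. *)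
Lemma theta_cycle P i p lev v k u (pi : seq T) i1 i2 :
  rooted_layer P i p lev v -> i.*2 < k -> path e u pi -> uniq (u :: pi) ->
  {subset u :: pi <= P} -> k <= i1 -> i1 < i2 -> i2 < size pi ->
  odd i1 -> odd i2 -> e u (nth u pi i1) -> e u (nth u pi i2) ->
  has_cycle e k.
Proof.
move=> PT ik pu uu uP ki1 i12 i2s o1 o2 e1 e2.
have d_gt0 h : h < i -> 0 < k - h.+1.*2.
  by move=> hi; rewrite subn_gt0 (leq_ltn_trans _ ik) // leq_double.
have dK h : h < i -> k - h.+1.*2 + h.+1.*2 = k.
  by move=> hi; rewrite subnK // ltnW // (leq_ltn_trans _ ik) // leq_double.
have [//|noC] := pselect (has_cycle e k); exfalso.
pose y t := nth u (u :: pi) t.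
have yP t : t <= i2.+1 -> y t \in P by move=> ti; apply: uP;
  apply: mem_nth => /=; lia.
pose same h := all (fun t => iter h p (y t) == iter h p u) (iota 0 i2.+2).
have ex_same : exists h, same h.
  exists i; apply/allP => t; rewrite mem_iota => ti.
  have [-> _ _] := PT _ (yP t ltac:(lia)).
  by have [-> _ _] := PT _ (yP 0 isT).
case: (ex_minnP ex_same) => h sameh minh.
have hi : h <= i.
  apply: minh; apply/allP => t; rewrite mem_iota => ti.
  have [-> _ _] := PT _ (yP t ltac:(lia)).
  by have [-> _ _] := PT _ (yP 0 isT).
have yinj : {in [pred t | t <= i2.+1] &, injective y}.
  move=> s t; rewrite !inE => si ti /eqP.
  by rewrite nth_uniq //=; [move/eqP| |]; lia.
case: h => [|h] in sameh minh hi *.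
  move/allP/(_ 1): sameh; rewrite mem_iota /= => /(_ isT)/eqP/(yinj 1 0).
  by rewrite !inE => /(_ isT isT).
pose chi t := iter h p (y t) == iter h p u.
(* The path up to [y i2.+1] and the two edges at [u] form the cycle with a chord for [D = i2.+1],
   which is even, and [M = i1.+1]. *)
have chiT : forall t, t <= i2.+1 -> chi t = chi 0.
  apply: (@theta_constant i2.+1 i1.+1 (k - h.+1.*2) chi) => //.
  - exact: d_gt0.
  - exact: leq_trans (leq_subr _ _) (leqW ki1).
  - by rewrite /= o2.
  move=> x q pq uq qD sq; apply: contrapT => /eqP chi_neq.
  apply: noC; rewrite (_ : k = size (map y q) + h.+1.*2); last first.
    by rewrite size_map sq dK.
  have qD' : {subset x :: q <= [pred t | t <= i2.+1]} by move=> z /(allP qD).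
  have lastq : last x q \in x :: q by apply: mem_last.
  apply: (@branch_cycle P i p lev v _ (y x) h PT) => //.
  - have yadj : {in [pred t | t <= i2.+1] &, forall a b,
        theta_adj i2.+1 i1.+1 a b -> e (y a) (y b)}.
      have ya t : t <= i2 -> e (y t) (y t.+1).
        by move=> ti; apply: (pathP u pu); apply: leq_ltn_trans i2s.
      move=> a b; rewrite !inE => ai bi /or4P[/eqP ab|/eqP ab||].
      + by rewrite ab in bi *; apply: ya.
      + by rewrite ab in ai *; rewrite e_sym; apply: ya.
      + by case/andP=> /eqP-> /orP[] /eqP ->.
      + by case/andP=> /eqP-> /orP[] /eqP ->; rewrite e_sym.
    have {}qD' : all [pred t | t <= i2.+1] (x :: q) by [].
    rewrite path_map; apply: (sub_in_path yadj) qD' pq.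
  - by rewrite -map_cons map_inj_in_uniq // => s t /qD' ? /qD' ?; apply: yinj.
  - move=> z; rewrite -map_cons => /mapP[t /qD' tD ->]; exact: yP.
  - rewrite last_map; move/allP: sameh => sameh.
    rewrite (eqP (sameh x _)) ?(eqP (sameh (last x q) _)) //.
      by rewrite mem_iota add0n ltnS; exact: (qD' _ lastq).
    by rewrite mem_iota add0n ltnS; exact: (qD' x (mem_head _ _)).
  - rewrite last_map; apply: contraNneq chi_neq => E.
    by rewrite /chi E.
suff : h.+1 <= h by rewrite ltnn.
apply: minh; apply/allP => t; rewrite mem_iota => ti.
have := chiT t ltac:(lia); rewrite /chi => ->; exact/eqP.
Qed.

End Layer.

(** * Separated sets and independence numbers *)

Section Alpha.
Variables (T : finType) (e : rel T).
Hypothesis e_sym : symmetric e.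

(** Disjointness is included so that sizes add up over a separated union. *)
Definition sep (A B : {set T}) : Prop :=
  forall x y, x \in A -> y \in B -> (x != y) && ~~ e x y.

Lemma sep_sym A B : sep A B -> sep B A.
Proof. by move=> sAB x y xB yA; rewrite eq_sym e_sym sAB. Qed.

Lemma sep_sub (A B A' B' : {set T}) :
  A' \subset A -> B' \subset B -> sep A B -> sep A' B'.
Proof. by move=> /subsetP sA /subsetP sB sAB x y /sA xA /sB yB; apply: sAB. Qed.

Lemma sepU A B C : sep A C -> sep B C -> sep (A :|: B) C.
Proof. by move=> sA sB x y /setUP[xA|xB] yC; [apply: sA|apply: sB]. Qed.

Lemma sepUr A B C : sep A B -> sep A C -> sep A (B :|: C).
Proof. by move=> sB sC x y xA /setUP[yB|yC]; [apply: sB|apply: sC]. Qed.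

Lemma card_sep A B : sep A B -> #|A :|: B| = #|A| + #|B|.
Proof.
move=> sAB; rewrite cardsU disjoint_setI0 ?cards0 ?subn0 //.
apply/pred0Pn => -[x /andP[xA xB]].
by have := sAB x x xA xB; rewrite eqxx.
Qed.

Lemma independentP (S : {set T}) :
  reflect {in S &, forall x y, ~~ e x y} (independent e S).
Proof.
apply: (iffP forall_inP) => [h x y xS yS|h x xS].
  by have /forall_inP := h x xS; apply.
by apply/forall_inP => y; apply: h.
Qed.

Lemma alpha_witness (X : {set T}) :
  exists S : {set T}, [/\ S \subset X, independent e S & #|S| = alpha e X].
Proof.
pose ok := [pred S : {set T} | (S \subset X) && independent e S].
have ok0 : 0 < #|ok|.
  apply/card_gt0P; exists set0; rewrite inE sub0set /=.
  by apply/independentP => x y; rewrite inE.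
have [S] := eq_bigmax_cond (fun S : {set T} => #|S|) ok0.
by rewrite inE => /andP[SX iS] ES; exists S.
Qed.

Lemma leq_alpha (X S : {set T}) :
  S \subset X -> independent e S -> #|S| <= alpha e X.
Proof.
move=> SX iS; rewrite /alpha.
by apply: (leq_bigmax_cond (F := fun S : {set T} => #|S|)); rewrite SX.
Qed.

Lemma alpha_mono (X Y : {set T}) : X \subset Y -> alpha e X <= alpha e Y.
Proof.
move=> XY; have [S [SX iS <-]] := alpha_witness X.
by apply: leq_alpha iS; apply: subset_trans XY.
Qed.

Lemma alpha_sepU A B : sep A B -> alpha e A + alpha e B <= alpha e (A :|: B).
Proof.
move=> sAB; have [S [SA iS <-]] := alpha_witness A.
have [S' [SB iS' <-]] := alpha_witness B.
rewrite -card_sep; last exact: sep_sub sAB.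
apply: leq_alpha; first exact: setUSS.
have sSS : sep S S' by exact: sep_sub sAB.
apply/independentP => x y /setUP[xS|xS] /setUP[yS|yS].
- exact: (independentP _ iS).
- by have /andP[] := sSS x y xS yS.
- by rewrite e_sym; have /andP[] := sSS y x yS xS.
- exact: (independentP _ iS').
Qed.

Lemma alpha_gt0 (X : {set T}) : irreflexive e -> X != set0 -> 0 < alpha e X.
Proof.
move=> e_irr /set0Pn[x xX]; rewrite -(cards1 x); apply: leq_alpha.
  by rewrite sub1set.
by apply/independentP => a b /set1P-> /set1P->; rewrite e_irr.
Qed.

End Alpha.

(* Rooted forests in left-child right-sibling form: [Node w c s] is the tree
   with root [w] above the forest [c], next to the forest [s]. *)
Inductive forest (T : Type) := Leaf | Node of T & forest T & forest T.
Arguments Leaf {T}.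

(** * Depth-first forests *)

Section Forest.
Variables (T : finType) (e : rel T).
Hypothesis e_sym : symmetric e.

Fixpoint vset (F : forest T) : {set T} :=
  if F is Node w c s then (w |: vset c) :|: vset s else set0.

(* The list passed to [Q] with a node consists of its ancestors, nearest first,
   followed by [pi]. *)
Fixpoint all_nodes (Q : T -> seq T -> Prop) (pi : seq T)
  (F : forest T) : Prop :=
  if F is Node w c s
  then [/\ Q w pi, all_nodes Q (w :: pi) c & all_nodes Q pi s] else True.

(** Distinct nodes joined by an edge are ancestor and descendant, as in a depth-first forest, and no
    vertex occurs twice. *)
Fixpoint normal (F : forest T) : Prop :=
  if F is Node w c s then
    [/\ w \notin vset c, sep e (w |: vset c) (vset s), normal c & normal s]
  else True.

Lemma all_nodes_impl (Q Q' : T -> seq T -> Prop) pi F :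
  (forall w st, w \in vset F -> {subset st <= [pred x | (x \in vset F) ||
    (x \in pi)]} ->
     Q w st -> Q' w st) ->
  all_nodes Q pi F -> all_nodes Q' pi F.
Proof.
elim: F pi => [//|w c IHc s IHs] pi /= QQ' [Qw Qc Qs]; split.
- apply: QQ' Qw; first by rewrite !inE eqxx.
  by move=> x xpi; rewrite inE xpi orbT.
- apply: IHc Qc => u st uc stc; apply: QQ'; first by rewrite !inE uc orbT.
  by move=> x /stc; rewrite !inE => /or3P[] ->; rewrite ?orbT.
- apply: IHs Qs => u st us sts; apply: QQ'; first by rewrite !inE us orbT.
  by move=> x /sts; rewrite !inE => /orP[] ->; rewrite ?orbT.
Qed.

Definition stack_path (P : {set T}) w pi :=
  [/\ path e w pi, uniq (w :: pi) & {subset w :: pi <= P}].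

(** With an empty stack every vertex qualifies, as the root of a new tree. *)
Definition below (pi : seq T) x := if pi is p :: _ then e x p else true.

(** Here [pi] is the stack and [S] the unvisited set. The search takes some [w] below the top of the
    stack, explores from [w], then resumes from [pi]. What stays unvisited has no neighbour in a
    finished subtree, so the forest is normal. *)
Lemma dfs_forest (P S : {set T}) (pi : seq T) :
  S \subset P -> {subset pi <= P} -> uniq pi -> sorted e pi ->
  [disjoint S & pi] ->
  exists F, [/\ vset F \subset S, normal F, all_nodes (stack_path P) pi F,
    sep e (vset F) (S :\: vset F) & {in S :\: vset F, forall x, ~~ below pi x}].
Proof.
have [m Sm] := ubnP #|S|.
elim: m => // m IHm in S pi Sm *.
move=> SP piP upi spi Spi.
have [/exists_inP[w wS wpi]|] := boolP [exists w in S, below pi w]; last first.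
  rewrite negb_exists_in => /forall_inP nb; exists Leaf; split => //=.
  - exact: sub0set.
  - by move=> x y; rewrite inE.
  - by move=> x; rewrite setD0 => /nb.
have w_pi : w \notin pi by apply: contraL Spi => wpi'; apply/pred0Pn;
  exists w; rewrite /= wS.
have pw : path e w pi by case: (pi) wpi spi => //= p pi' -> ->.
have [||||||F1 [F1S nF1 aF1 sF1 bF1]] := IHm (S :\ w) (w :: pi).
- by have := cardsD1 w S; rewrite wS; lia.
- by apply: subset_trans SP; apply: subD1set.
- by move=> x; rewrite inE => /orP[/eqP->|/piP//]; apply: (subsetP SP).
- by rewrite /= w_pi.
- by rewrite /=.
- rewrite disjoint_sym; apply/pred0P => x /=; rewrite !inE.
  have [//|xw /=] := eqVneq x w.
  apply/negP => /andP[xpi xS].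
  by move/pred0P/(_ x): Spi; rewrite /= xpi xS.
pose S2 := S :\: (w |: vset F1).
have S2S : S2 \subset S by apply: subsetDl.
have [||||||F2 [F2S nF2 aF2 sF2 bF2]] := IHm S2 pi.
- apply: leq_trans (_ : #|S| <= m) => //; apply: proper_card; apply/properP.
  by split=> //; exists w => //; rewrite !inE eqxx.
- exact: subset_trans SP.
- by [].
- by [].
- by [].
- by apply: disjointWl Spi.
have wF1 : w \notin vset F1.
  by apply/negP => /(subsetP F1S); rewrite !inE eqxx.
have sep12 : sep e (w |: vset F1) S2.
  move=> x y; rewrite !inE negb_or => /orP[/eqP->|xF1] /andP[/andP[yw yF1] yS].
    rewrite eq_sym yw /= e_sym.
    by have := bF1 y; rewrite !inE yw yF1 yS => /(_ isT).
  by apply: sF1 => //; rewrite !inE yw yF1 yS.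
exists (Node w F1 F2); split => /=.
- rewrite !subUset sub1set wS (subset_trans F1S) ?subD1set //=.
  exact: subset_trans S2S.
- by split=> //; apply: sep_sub sep12.
- split=> //; split=> //; first by rewrite /= w_pi.
  by move=> x; rewrite inE => /orP[/eqP->|/piP//]; apply: (subsetP SP).
- apply: sepU; first apply: sep_sub sep12 => //.
    by rewrite setDUr subsetIl.
  by apply: sep_sub sF2 => //; rewrite setDDl.
- by move=> x xS; apply: bF2; rewrite setDDl.
Qed.

Lemma dfs_spanning (P : {set T}) :
  exists F, [/\ vset F = P, normal F & all_nodes (stack_path P) [::] F].
Proof.
have [|||||F [FP nF aF _ bF]] := @dfs_forest P P [::] => //.
  by rewrite disjoint_sym; apply/pred0P.
exists F; split=> //; apply/eqP; rewrite eqEsubset FP; apply/subsetP => x xP.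
by apply: contraT => xF; have := bF x; rewrite !inE xF xP => /(_ isT).
Qed.

End Forest.

(** * Four-colouring the long upward edges *)

Section Colouring.
Variables (T : finType) (e : rel T) (l : nat).
Hypothesis e_sym : symmetric e.

(* The ancestor [nth w pi i] is [i.+1] levels above [w]. *)
Definition one_long_even w pi := uniq (w :: pi) /\
  forall i1 i2, l <= i1 -> i1 < i2 -> i2 < size pi -> odd i1 -> odd i2 ->
    e w (nth w pi i1) -> e w (nth w pi i2) -> False.

Definition long_proper (col : T -> bool * bool) w pi :=
  forall i, l <= i -> i < size pi -> e w (nth w pi i) ->
    col w != col (nth w pi i).

(** Nodes are coloured from the roots down, with the ancestors' colours fixed. The first bit is the
    depth parity; the second differs from that at the upper end of the long edge of even depth
    difference, if there is one. *)
Lemma long_colouring_stack F pi (col : T -> bool * bool) :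
  normal e F -> [disjoint vset F & pi] -> all_nodes one_long_even pi F ->
  (forall w i, i < size pi -> (col (nth w pi i)).1 = odd (size pi - i.+1)) ->
  exists col', (forall x, x \notin vset F -> col' x = col x) /\
    all_nodes (long_proper col') pi F.
Proof.
elim: F pi col => [|w c IHc s IHs] pi col /=; first by exists col.
move=> [wc scs nc ns] dF [[uw ow] oc os] colpi.
(* As [nth w pi i] is [i.+1] levels up, odd [i] means equal depth parity. *)
pose bad i := [&& l <= i, i < size pi, odd i & e w (nth w pi i)].
have [b bP] : exists b, forall i, bad i -> b != (col (nth w pi i)).2.
  have [[i0 bi0]|nb] := pselect (exists i, bad i); last first.
    by exists true => i bi; case: nb; exists i.
  exists (~~ (col (nth w pi i0)).2) => i bi.
  suff -> : i = i0 by case: (col _).2.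
  have [/and4P[li si oi ei] /and4P[l0 s0 o0 e0]] := (bi, bi0).
  apply/eqP; rewrite eqn_leq; apply/andP; split; rewrite leqNgt;
  apply/negP => lt.
    exact: (ow i0 i).
  exact: (ow i i0).
pose col1 x := if x == w then (odd (size pi), b) else col x.
have dFx x : x \in vset (Node w c s) -> x \notin pi.
  by move=> xF; apply/negP => xpi; move/pred0P/(_ x): dF; rewrite /= xpi;
  rewrite /= in xF; rewrite xF.
have w_pi : w \notin pi by apply: dFx; rewrite /= !inE eqxx.
have c_pi x : x \in vset c -> x \notin pi by move=> xc; apply: dFx;
  rewrite /= !inE xc orbT.
have s_pi x : x \in vset s -> x \notin pi by move=> xc; apply: dFx;
  rewrite /= !inE xc !orbT.
have s_c x : x \in w |: vset c -> x \notin vset s.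
  by move=> xc; apply/negP => xs; have := scs x x xc xs; rewrite eqxx.
have nthw u i : i < size pi -> (nth u pi i == w) = false.
  by move=> ip; apply/negP => /eqP E; move: w_pi; rewrite -E mem_nth.
have [||col2 [col2E col2P]] := IHc (w :: pi) col1 nc _ oc.
- apply/pred0P => x /=; rewrite inE; apply/negP => /andP[xc /orP[/eqP xw|]].
    by move: wc; rewrite -xw xc.
  exact/negP/c_pi.
- move=> u [|i] /= ip; first by rewrite /col1 eqxx /= subn1.
  by rewrite /col1 nthw // colpi // subSS.
have col2pi x : x \in pi -> col2 x = col x.
  move=> xpi; rewrite col2E; last by apply: contraL xpi => /c_pi.
  by rewrite /col1; case: eqP => // E; move: w_pi; rewrite -E xpi.
have col2w : col2 w = (odd (size pi), b) by rewrite col2E // /col1 eqxx.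
have [||col3 [col3E col3P]] := IHs pi col2 ns _ os.
- by apply/pred0P => x /=; apply/negP => /andP[/s_pi/negP].
- by move=> u i ip; rewrite col2pi ?mem_nth // colpi.
have col3pi x : x \in pi -> col3 x = col x.
  by move=> xpi; rewrite col3E ?col2pi //; apply: contraL xpi => /s_pi.
have col3w : col3 w = (odd (size pi), b).
  by rewrite col3E ?col2w // s_c // !inE eqxx.
exists col3; split.
- move=> x; rewrite !inE !negb_or => /andP[/andP[xw xc] xs].
  by rewrite col3E // col2E // /col1 (negbTE xw).
split=> //.
- move=> i li ip ei; rewrite col3w col3pi ?mem_nth //.
  apply/eqP => E; have bi : bad i.
    rewrite /bad li ip ei andbT /=; move: (congr1 fst E).
    by rewrite /= colpi // oddB //=; case: (odd (size pi)); case: (odd i).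
  by have /eqP := bP i bi; apply; rewrite -E.
- apply: all_nodes_impl col2P => u st uc stc up i li ip ei.
  have uin : u \in w |: vset c by rewrite !inE uc orbT.
  rewrite col3E ?s_c // [col3 _](_ : _ = col2 (nth u st i)); first exact: up.
  have := stc _ (mem_nth u ip); rewrite !inE => /or3P[nc'|/eqP->|npi].
  + by rewrite col3E // s_c // !inE nc' orbT.
  + by rewrite col3w col2w.
  + by rewrite col3pi // col2pi.
Qed.

(* Depth parity separates the ends of the long edges with an odd depth
   difference; of the others each vertex has at most one going up. *)
Lemma long_colouring F : normal e F -> all_nodes one_long_even [::] F ->
  exists col, all_nodes (long_proper col) [::] F.
Proof.
move=> nF oF.
have [||||col [_ colP]] := @long_colouring_stack F [::] (fun _ =>
  (true, true)) => //.
  by rewrite disjoint_sym; apply/pred0P.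
by exists col.
Qed.

Lemma large_class (P : {set T}) (col : T -> bool * bool) :
  exists c, #|P| <= 4 * #|[set x in P | col x == c]|.
Proof.
apply: contrapT => H.
have lt c : 4 * #|[set x in P | col x == c]| < #|P|.
  by rewrite ltnNge; apply/negP => ?; apply: H; exists c.
have E : #|P| = \sum_(c : bool * bool) #|[set x in P | col x == c]|.
  rewrite -sum1_card (partition_big col predT) //=; apply: eq_bigr => c _.
  by rewrite -sum1_card; apply: eq_bigl => x; rewrite inE.
move: E; rewrite -(pair_bigA _ (fun a b => #|[set x in P | col x ==
  (a, b)]|)) /=.
rewrite !big_bool /=.
have := lt (true, true); have := lt (true, false).
have := lt (false, true); have := lt (false, false); lia.
Qed.

End Colouring.

(** * Separators in a forest without long edges *)

Section Separate.
Local Open Scope ring_scope.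
Variables (R : realFieldType) (T : finType) (e : rel T) (l : nat).
Hypothesis e_sym : symmetric e.
Hypothesis l_gt0 : (0 < l)%N.
Variables (y : R) (W : {set T}).

(** The ratio of size to [alpha] is at most [y], multiplied out to cover the empty set. *)
Definition alpha_dense (X : {set T}) : Prop := #|X|%:R <= y * (alpha e X)%:R.

Lemma alpha_dense_sepU A B :
  0 <= y -> sep e A B -> alpha_dense A -> alpha_dense B -> alpha_dense
    (A :|: B).
Proof.
rewrite /alpha_dense => y0 sAB dA dB.
have aU := alpha_sepU e_sym sAB.
rewrite (card_sep sAB) natrD; apply: (le_trans (lerD dA dB)).
by rewrite -mulrDr -natrD ler_wpM2l // ler_nat.
Qed.

Hypothesis y_ge0 : 0 <= y.
Hypothesis small_dense :
  forall X : {set T}, X \subset W -> (#|X| <= 8 * l)%N -> alpha_dense X.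

Definition no_long w pi := w \in W ->
  forall a, a \in drop l pi -> a \in W -> (w != a) && ~~ e w a.

Lemma no_long_vset F pi : all_nodes no_long pi F ->
  sep e (W :&: vset F) (W :&: [set a in drop l pi]).
Proof.
elim: F pi => [|w c IHc s IHs] pi /= => [_ x a|[Qw Qc Qs] x a].
  by rewrite setI0 inE.
rewrite !inE => /andP[xW /orP[/orP[/eqP xw|xc]|xs]] /andP[aW adr].
- by rewrite xw in xW *; apply: Qw.
- have {}adr : a \in drop l.-1 pi.
    rewrite (_ : l = 1 + l.-1)%N in adr; last lia.
    by rewrite -drop_drop in adr; apply: mem_drop adr.
  have dl : drop l (w :: pi) = drop l.-1 pi by case: (l) l_gt0.
  by apply: (IHc _ Qc); rewrite !inE ?dl ?xW ?aW.
- by apply: (IHs _ Qs); rewrite !inE ?xW ?aW.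
Qed.

(* [C] is finished, [A] is a small set still attached to the ancestors, and
   [D] is deleted at a cost of at most [l] vertices per [8 * l] finished. *)
Lemma separate_stack F pi : normal e F -> all_nodes no_long pi F ->
  exists C A D : {set T},
    [/\ C :|: A \subset W :&: vset F,
        W :&: vset F \subset C :|: A :|: D,
        sep e C (A :|: (W :&: [set a in pi] :\: D)) &
        [/\ (#|A| < 8 * l)%N, (8 * #|D| <= #|C|)%N & alpha_dense C]].
Proof.
elim: F pi => [|w c IHc s IHs] pi.
  move=> _ _; exists finset.set0, finset.set0, finset.set0; split=> //=.
  - by rewrite setI0 !setU0.
  - by rewrite setI0 sub0set.
  - by move=> x z; rewrite inE.
  - by split; rewrite /alpha_dense ?cards0 ?mulr_ge0 ?muln_gt0.
move=> nF aF; have lF := no_long_vset aF.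
move: nF aF => /= [wc scs nc ns] [_ ac as_].
have [C1 [A1 [D1 [s1 c1 e1 [A1s D1s C1d]]]]] := IHc _ nc ac.
have [C2 [A2 [D2 [s2 c2 e2 [A2s D2s C2d]]]]] := IHs _ ns as_.
(* The root [w], unless it lies outside [W] or is already deleted in [D1]. *)
pose w' := W :&: [set w] :\: D1.
move: s1 s2; rewrite !subUset => /andP[C1s A1sub] /andP[C2s A2sub].
have C1c : C1 \subset w |: vset c.
  by apply: subset_trans C1s _; apply: subset_trans (subsetIr _ _) _;
  apply: subsetUr.
have A1c : A1 \subset w |: vset c.
  by apply: subset_trans A1sub _; apply: subset_trans (subsetIr _ _) _;
  apply: subsetUr.
have w'c : w' \subset w |: vset c.
  by rewrite /w'; apply: subset_trans (subsetDl _ _) _;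
  apply: subset_trans (subsetIr _ _) _; apply: subsetUl.
have C2v : C2 \subset vset s by apply: subset_trans C2s _; apply: subsetIr.
have A2v : A2 \subset vset s by apply: subset_trans A2sub _; apply: subsetIr.
have w'W : w' \subset W by apply: subset_trans (subsetDl _ _) _;
  apply: subsetIl.
have sC12 : sep e C1 C2 by apply: sep_sub scs.
have subV : (C1 :|: C2) :|: (A1 :|: w' :|: A2) \subset W :&:
  ((w |: vset c) :|: vset s).
  rewrite !subUset !subsetI w'W.
  rewrite (subset_trans C1s (subsetIl _ _)) (subset_trans C2s (subsetIl _ _)).
  rewrite (subset_trans A1sub (subsetIl _ _)) (subset_trans A2sub
    (subsetIl _ _)).
  rewrite (subset_trans C1c (subsetUl _ _)) (subset_trans A1c (subsetUl _ _)).
  by rewrite (subset_trans w'c (subsetUl _ _)) (subset_trans C2v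
    (subsetUr _ _)) (subset_trans A2v (subsetUr _ _)).
have cover : W :&: ((w |: vset c) :|: vset s) \subset
    (C1 :|: C2) :|: (A1 :|: w' :|: A2) :|: (D1 :|: D2).
  apply/subsetP => x; rewrite !inE => /andP[xW /orP[/orP[/eqP xw|xc]|xs]].
  - by rewrite xw in xW *; rewrite xW eqxx /=; case: (w \in D1); rewrite !orbT.
  - have := subsetP c1 x; rewrite !inE xW xc => /(_ isT).
    by case/orP=> [/orP[]|] ->; rewrite ?orbT.
  - have := subsetP c2 x; rewrite !inE xW xs => /(_ isT).
    by case/orP=> [/orP[]|] ->; rewrite ?orbT.
have CA : sep e (C1 :|: C2) (A1 :|: w' :|: A2).
  apply: sepUr; first apply: sepUr; apply: sepU.
  - by apply: sep_sub e1 => //; apply: subsetUl.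
  - by apply: (sep_sym e_sym); apply: sep_sub scs.
  - apply: sep_sub e1 => //; apply: subset_trans (subsetUr _ _).
    by apply: setSD; apply: setIS; apply/subsetP => x; rewrite !inE => ->.
  - by apply: (sep_sym e_sym); apply: sep_sub scs.
  - by apply: sep_sub scs.
  - by apply: sep_sub e2 => //; apply: subsetUl.
have CD : sep e (C1 :|: C2) (W :&: [set a in pi] :\: (D1 :|: D2)).
  apply: sepU.
  - apply: sep_sub e1 => //; apply: subset_trans (subsetUr _ _).
    apply/subsetP => x; rewrite !inE negb_or => /and3P[/andP[-> _] -> ->].
    by rewrite orbT.
  - apply: sep_sub e2 => //; apply: subset_trans (subsetUr _ _).
    by apply: setDS; apply: subsetUr.
have cC := card_sep sC12.
have cD : (#|D1 :|: D2| <= #|D1| + #|D2|)%N by rewrite cardsU leq_subr.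
have cCD : (8 * #|D1 :|: D2| <= #|C1 :|: C2|)%N.
  rewrite cC; apply: leq_trans (leq_add D1s D2s).
  by rewrite -mulnDr leq_pmul2l.
have dC : alpha_dense (C1 :|: C2) by apply: alpha_dense_sepU.
have [Asmall|Alarge] := ltnP #|A1 :|: w' :|: A2| (8 * l).
  exists (C1 :|: C2), (A1 :|: w' :|: A2), (D1 :|: D2); split=> //.
  exact: sepUr.
have sA12 : sep e (A1 :|: w') A2.
  by apply: sep_sub scs => //; rewrite subUset A1c.
have cw' : (#|A1 :|: w'| <= 8 * l)%N.
  have : (#|w'| <= 1)%N.
    rewrite -(cards1 w); apply: subset_leq_card.
    by apply: subset_trans (subsetDl _ _) _; apply: subsetIr.
  have : (#|A1 :|: w'| <= #|A1| + #|w'|)%N by rewrite cardsU leq_subr.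
  move=> /leq_trans h w1; apply: h; apply: leq_trans A1s.
  by rewrite -addn1 leq_add2l.
have AW : A1 :|: w' \subset W.
  by rewrite subUset w'W (subset_trans A1sub (subsetIl _ _)).
(* The two separated parts have at most [8 * l] vertices each, so their union is dense although it
   may be larger. *)
have dA : alpha_dense (A1 :|: w' :|: A2).
  apply: alpha_dense_sepU => //; apply: small_dense => //.
    exact: subset_trans A2sub (subsetIl _ _).
  exact: ltnW.
(* A large attached set becomes finished by deleting the nearest [l] ancestors: farther ones in [W]
   have no edges to it, and its at least [8 * l] vertices pay for the deletion. *)
exists ((C1 :|: C2) :|: (A1 :|: w' :|: A2)), finset.set0,
  ((D1 :|: D2) :|: [set a in take l pi]); split=> //.
- by rewrite setU0.
- by rewrite setU0; apply: subset_trans cover _; apply: setUS; apply: subsetUl.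
- rewrite set0U; apply: sepU.
    by apply: sep_sub CD => //; apply: setDS; apply: subsetUl.
  apply: sep_sub lF.
    by apply: subset_trans subV; apply: subsetUr.
  apply/subsetP => x; rewrite !inE !negb_or => /and3P[/andP[_ xt] -> xpi].
  by rewrite -(cat_take_drop l pi) mem_cat (negbTE xt) in xpi.
split; first by rewrite cards0 muln_gt0.
  rewrite (card_sep CA).
  have : (#|D1 :|: D2 :|: [set a in take l pi]| <=
    #|D1 :|: D2| + #|[set a in take l pi]|)%N.
    by rewrite cardsU leq_subr.
  have : (#|[set a in take l pi]| <= l)%N.
    rewrite cardsE; apply: leq_trans (card_size _) _.
    by rewrite size_take_min geq_minl.
  move=> dl /leq_trans h; apply: leq_trans (leq_add cCD Alarge).
  by rewrite -mulnDr leq_pmul2l //; apply: h; rewrite leq_add2l.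
exact: alpha_dense_sepU.
Qed.

(** Since [8 * #|D| <= #|C|], the dense set [C :|: A] has at least 8/9 of the vertices of [W]. *)
Lemma separate F : normal e F -> all_nodes no_long [::] F -> W \subset vset F ->
  8 * #|W|%:R <= 9 * (y * (alpha e W)%:R).
Proof.
move=> nF aF /setIidPl WF.
have [C [A [D]]] := separate_stack nF aF; rewrite WF.
move=> [CAW WCAD sC [As Ds Cd]].
move: CAW; rewrite subUset => /andP[CW AW].
have sCA : sep e C A by apply: sep_sub sC => //; apply: subsetUl.
have Ad : alpha_dense A by apply: small_dense => //; apply: ltnW.
have := alpha_dense_sepU y_ge0 sCA Cd Ad; rewrite /alpha_dense => CAd.
have CAa : (alpha e (C :|: A) <= alpha e W)%N by apply: alpha_mono;
  rewrite subUset CW.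
have {}CAd : #|C :|: A|%:R <= y * (alpha e W)%:R.
  by apply: le_trans CAd _; rewrite ler_wpM2l // ler_nat.
have : (8 * #|W| <= 9 * #|C :|: A|)%N.
  have := subset_leq_card WCAD.
  have : (#|C :|: A :|: D| <= #|C :|: A| + #|D|)%N by rewrite cardsU leq_subr.
  rewrite (card_sep sCA) mulnDr => h /leq_trans /(_ h); move: Ds.
  move: (#|W|) (#|C|) (#|A|) (#|D|) => a b c d; lia.
rewrite -(ler_nat R) !natrM => /le_trans; apply.
by rewrite ler_wpM2l.
Qed.

End Separate.

(** * Breadth-first layers and their alternating unions *)

Section BFS.
Variables (T : finType) (e : rel T).
Hypothesis e_sym : symmetric e.
Variables (X : {set T}) (v : T).
Hypothesis vX : v \in X.

Fixpoint ball n : {set T} :=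
  if n is m.+1 then ball m :|: [set x in X | [exists z in ball m, e z x]]
  else [set v].

Definition layer n := if n is m.+1 then ball n :\: ball m else ball 0.

Fixpoint alternate n : {set T} :=
  match n with
  | m.+2 => layer n :|: alternate m
  | _ => layer n
  end.

Lemma ball_sub n : ball n \subset X.
Proof.
elim: n => [|n IHn] /=; first by rewrite sub1set.
by rewrite subUset IHn; apply/subsetP => x; rewrite inE => /andP[].
Qed.

Lemma ball_mono m n : m <= n -> ball m \subset ball n.
Proof.
move=> /subnK <-; elim: (n - m) => [//|d IHd].
by apply: subset_trans IHd _; apply: subsetUl.
Qed.

Lemma layer_ball n : layer n \subset ball n.
Proof. by case: n => // n; apply: subsetDl. Qed.

Lemma layer_inj m n x : x \in layer m -> x \in layer n -> m = n.
Proof.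
wlog mn : m n / m <= n => [H xm xn|].
  by have /orP[mn|nm] := leq_total m n; [|symmetry]; apply: H.
move=> xm; case: n mn => [|n] mn; first by lia.
rewrite inE => /andP[xn _]; apply/eqP; rewrite eqn_leq mn ltnNge.
apply: contra xn => mn'; apply: (subsetP (ball_mono mn')).
exact: (subsetP (layer_ball m)).
Qed.

Lemma ball_sep n : sep e (ball n) (X :\: ball n.+1).
Proof.
move=> x z xn; rewrite inE => /andP[zn zX]; apply/andP; split.
  by apply: contraNneq zn => <-; apply: (subsetP (ball_mono (leqnSn n))).
by apply: contra zn => xz; rewrite /= !inE zX; apply/orP; right;
apply/exists_inP; exists x.
Qed.

Lemma layer_pred n x : x \in layer n.+1 -> exists2 z, z \in layer n & e x z.
Proof.
rewrite /= !inE => /andP[xn]; rewrite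
  (negbTE xn) /= => /andP[xX /exists_inP[z zn zx]].
exists z; last by rewrite e_sym.
case: n xn zn => [//|n] xn zn; rewrite inE zn andbT.
apply: contra xn => zn'; rewrite /= !inE xX; apply/orP; right.
by apply/exists_inP; exists z.
Qed.

(** The parent of a vertex is a chosen neighbour in the previous layer; [lev] is the index of the
    layer, with default 0 outside the layers up to [n]. *)
Lemma rooted_layerP n : exists p lev, rooted_layer e (layer n) n p lev v.
Proof.
pose lev x := if [pick m : 'I_n.+1 | x \in layer m] is Some m then val m else 0.
have levE m x : m <= n -> x \in layer m -> lev x = m.
  move=> mn xm; rewrite /lev; case: pickP => [m' xm'|];
    first exact: layer_inj xm.
  by move=> /(_ (Ordinal (mn : m < n.+1))); rewrite /= xm.
pose p x := odflt v [pick z in layer (lev x).-1 | e x z].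
have pP m x : m.+1 <= n -> x \in layer m.+1 -> (p x \in layer m) && e x (p x).
  move=> mn xm; rewrite /p (levE m.+1) //=; case: pickP => [z //|].
  by have [z zm xz] := layer_pred xm; move/(_ z); rewrite /= zm xz.
exists p, lev => u un.
have itP j : j <= n -> iter j p u \in layer (n - j).
  elim: j => [|j IHj] jn /=; first by rewrite subn0.
  have := IHj (ltnW jn); rewrite (_ : n - j = (n - j.+1).+1); last lia.
  have jn' : (n - j.+1).+1 <= n by lia.
  by move=> /(pP _ _ jn') /andP[].
split.
- by have := itP n (leqnn n); rewrite subnn inE => /eqP.
- by move=> j jn; apply: levE; [lia|apply: itP].
- move=> j jn; have := itP j (ltnW jn).
  rewrite (_ : n - j = (n - j.+1).+1); last lia.
  have jn' : (n - j.+1).+1 <= n by lia.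
  by move=> /(pP _ _ jn') /andP[].
Qed.

Lemma alternate_ball n : alternate n \subset ball n.
Proof.
have [m nm] := ubnP n; elim: m => // m IHm in n nm *.
case: n nm => [|[|n]] nm; [exact: layer_ball|exact: layer_ball|].
rewrite subUset layer_ball /=;
apply: subset_trans (ball_mono (leqW (leqnSn n))).
by apply: IHm; lia.
Qed.

Lemma ball_alternate n : ball n.+1 \subset alternate n :|: alternate n.+1.
Proof.
elim: n => [|n IHn].
  by apply/subsetP => x; rewrite /= !inE; case: (x == v).
apply/subsetP => x xn; apply/setUP.
have [xn'|xn'] := boolP (x \in ball n.+1).
  have /setUP[xa|xa] := subsetP IHn x xn'; last by left.
  by right; apply/setUP; right.
by right; apply/setUP; left; rewrite in_setD xn' xn.
Qed.

Lemma alternate_sep n : sep e (layer n.+2) (alternate n).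
Proof.
apply: (sep_sym e_sym); apply: sep_sub (@ball_sep n).
  exact: alternate_ball.
by apply: setSD; apply: ball_sub.
Qed.

(** Otherwise the alternating unions grow from size 1 by more than the factor [b] each time, and the
    one at [r.+1] exceeds [b ^ r.+1]. *)
Lemma slow_growth b r : #|X| <= b ^ r.+1 ->
  exists2 n, n <= r & #|alternate n.+1| <= b * #|alternate n|.
Proof.
move=> Xb; apply: contrapT => H.
have grow n : n <= r -> b * #|alternate n| < #|alternate n.+1|.
  by move=> nr; rewrite ltnNge; apply/negP => h; apply: H; exists n.
have ge n : n <= r -> b ^ n <= #|alternate n|.
  elim: n => [|n IHn] nr; first by rewrite /= cards1.
  apply: leq_trans (ltnW (grow n (ltnW nr))).
  by rewrite expnS leq_mul2l IHn ?orbT // ltnW.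
have := grow r (leqnn r).
rewrite ltnNge => /negP; apply; apply: leq_trans (_ : b ^ r.+1 <= _).
  apply: leq_trans Xb; apply: subset_leq_card.
  exact: subset_trans (alternate_ball _) (ball_sub _).
by rewrite expnS leq_mul2l ge ?orbT.
Qed.

End BFS.

(** * Combining layers, colours and separators *)

Section Dense.
Local Open Scope ring_scope.
Variables (R : realFieldType) (T : finType) (e : rel T) (k : nat) (y : R).
Hypothesis e_sym : symmetric e.
Hypothesis no_cycle : ~ has_cycle e k.
Hypothesis y_ge0 : 0 <= y.

Lemma all_nodes_and (Q1 Q2 : T -> seq T -> Prop) pi F :
  all_nodes Q1 pi F -> all_nodes Q2 pi F ->
  all_nodes (fun w st => Q1 w st /\ Q2 w st) pi F.
Proof.
elim: F pi => [//|w c IHc s IHs] pi /= [? ? ?] [? ? ?].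
by split; [|apply: IHc|apply: IHs].
Qed.

(** By [theta_cycle] each node has at most one long upward edge of even depth difference. A colour
    class costs a factor 4 and the separators 9/8. *)
Lemma layer_dense (P : {set T}) i p lev v :
  rooted_layer e P i p lev v -> (i.*2 < k)%N ->
  (forall X : {set T}, X \subset P -> (#|X| <= 8 * k)%N -> alpha_dense e y X) ->
  2 * #|P|%:R <= 9 * (y * (alpha e P)%:R).
Proof.
move=> PT ik smallP.
have k0 : (0 < k)%N by exact: leq_ltn_trans ik.
have [F [FP nF sF]] := dfs_spanning e_sym P.
have oF : all_nodes (one_long_even e k) [::] F.
  apply: all_nodes_impl sF => w st _ _ [pw uw wP]; split=> //.
  move=> i1 i2 ki1 i12 i2s o1 o2 e1 e2; apply: no_cycle.
  exact: (theta_cycle e_sym PT ik pw uw wP ki1 i12 i2s o1 o2 e1 e2).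
have [col colP] := long_colouring nF oF.
have [c cP] := large_class P col.
pose W := [set x in P | col x == c].
have WP : W \subset P by apply/subsetP => x; rewrite inE => /andP[].
have lF : all_nodes (no_long e k W) [::] F.
  apply: all_nodes_impl (all_nodes_and sF colP) => w st _ _ [[_ uw _] cw].
  rewrite /no_long inE => /andP[_ /eqP wc] a ad;
  rewrite inE => /andP[_ /eqP ac].
  have ast := mem_drop ad; apply/andP; split.
    by apply: contraTneq uw => ->; rewrite /= ast.
  have [j jd ja] := nthP w ad; rewrite nth_drop in ja; rewrite size_drop in jd.
  apply/negP => ea; have := cw (k + j)%N (leq_addr _ _).
  rewrite ja wc ac eqxx => /(_ _ ea) h.
  by have // : false; apply: h; move: jd; move: (size st) => m; lia.
have := separate e_sym k0 y_ge0 (W := W) _ nF lF.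
rewrite FP => /(_ _ WP) sepW.
have {}sepW : 8 * #|W|%:R <= 9 * (y * (alpha e W)%:R).
  by apply: sepW => X XW; apply: smallP; apply: subset_trans WP.
have aW : (alpha e W)%:R <= (alpha e P)%:R :> R by rewrite ler_nat alpha_mono.
have := ler_wpM2l y_ge0 aW; move: cP; rewrite -(ler_nat R) natrM -/W; lra.
Qed.

(** Where growth is slow, [alternate n] has at least 1/11 of the size of [ball n.+1] and is
    separated from the rest, to which induction applies. The constant is [99 / 2 = 11 * (9 / 2)]. *)
Lemma bfs_dense (X : {set T}) (rho : nat) : (rho.*2 < k)%N ->
  (forall Y : {set T}, Y \subset X -> (#|Y| <= 8 * k)%N -> alpha_dense e y Y) ->
  (#|X| <= 10 ^ rho.+1)%N ->
  2 * #|X|%:R <= 99 * (y * (alpha e X)%:R).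
Proof.
move=> rk; have [m Xm] := ubnP #|X|.
elim: m => // m IHm in X Xm * => smallX Xb.
have [->|/set0Pn[v vX]] := eqVneq X finset.set0.
  by rewrite cards0 mulr0 !mulr_ge0.
have [n nr En] := slow_growth e vX Xb.
have bX := ball_sub e vX.
have layD j : (j <= n)%N ->
    2 * #|layer e X v j|%:R <= 9 * (y * (alpha e (layer e X v j))%:R).
  move=> jn; have [p [lev PT]] := rooted_layerP e_sym vX j.
  apply: (layer_dense PT); first by apply: leq_ltn_trans rk;
  rewrite leq_double; apply: leq_trans nr.
  move=> Y YP; apply: smallX; apply: subset_trans YP _.
  by apply: subset_trans (layer_ball _ _ _ _) _; apply: bX.
have altD j : (j <= n)%N ->
    2 * #|alternate e X v j|%:R <= 9 * (y * (alpha e (alternate e X v j))%:R).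
  have [m' jm'] := ubnP j; elim: m' => // m' IHm' in j jm' *.
  case: j jm' => [|[|j]] jm' jn; [exact: layD|exact: layD|].
  have sj := alternate_sep e_sym vX (n := j).
  have -> : alternate e X v j.+2 = layer e X v j.+2 :|: alternate e X v j by [].
  rewrite (card_sep sj) natrD.
  have jm : (j < m')%N by lia.
  have jn' : (j <= n)%N by lia.
  have := IHm' j jm jn'.
  have := layD j.+2 jn.
  have := alpha_sepU e_sym sj; rewrite -(ler_nat R) natrD => /(ler_wpM2l y_ge0).
  lra.
pose X' := X :\: ball e X v n.+1.
have sX' : sep e (alternate e X v n) X'.
  by apply: sep_sub (@ball_sep _ e X v n) => //; exact: (alternate_ball e vX).
have aX : (alpha e (alternate e X v n) + alpha e X' <= alpha e X)%N.
  apply: leq_trans (alpha_sepU e_sym sX') _; apply: alpha_mono.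
  by rewrite subUset subsetDl (subset_trans (alternate_ball e vX n)) ?bX.
have cX : (#|X| <= #|X'| + 11 * #|alternate e X v n|)%N.
  rewrite -(cardsID (ball e X v n.+1) X) (setIidPr (bX n.+1)) addnC leq_add2l.
  apply: leq_trans (subset_leq_card (ball_alternate _ _ _ _)) _.
  by rewrite cardsU; apply: leq_trans (leq_subr _ _) _; rewrite mulSn leq_add2l.
have X'X : X' \subset X by exact: subsetDl.
have dX' : 2 * #|X'|%:R <= 99 * (y * (alpha e X')%:R).
  apply: IHm.
  - apply: leq_trans (_ : #|X| <= m)%N => //; apply: proper_card; apply/properP.
    split=> //; exists v => //; rewrite inE negb_and negbK; apply/orP; left.
    by apply: (subsetP (ball_mono e X v (leq0n n.+1))); rewrite inE.
  - by move=> Y YX'; apply: smallX; apply: subset_trans YX' _.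
  - exact: leq_trans (subset_leq_card X'X) Xb.
have := altD n (leqnn n).
move: aX cX; rewrite -(ler_nat R) natrD => /(ler_wpM2l y_ge0) aX.
rewrite -(ler_nat R) natrD natrM => cX; lra.
Qed.

End Dense.

(* Imported only here because [classical_sets] shadows the [finset] notations. *)
From mathcomp Require Import classical_sets reals sequences exp.

Local Open Scope ring_scope.

(** * Numerical bounds on the exponential *)

Section ExpBounds.
Variable R : realType.

Lemma expR_double (x : R) : expR (2 * x) = expR x * expR x.
Proof. by rewrite mulr_natl mulr2n expRD. Qed.

(** Five rounded squarings of the bounds on [expR (1 / 32)] that [1 + x <= expR x] gives at [1 / 32]
    and [- (1 / 32)]. *)
Lemma expR1_bounds : 266 / 100 <= expR (1 : R) <= 280 / 100.
Proof.
have lo (x a b : R) : 0 <= a -> a <= expR x -> b <= a * a -> b <= expR (2 * x).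
  move=> a0 ax ba; rewrite expR_double; apply: le_trans ba _.
  by apply: ler_pM.
have up (x a b : R) : expR x <= a -> a * a <= b -> expR (2 * x) <= b.
  move=> ax ab; rewrite expR_double; apply: le_trans _ ab.
  by apply: ler_pM; rewrite ?expR_ge0.
have E : 1 = 2 * (2 * (2 * (2 * (2 * (1 / 32))))) :> R by lra.
have h0 : 33 / 32 <= expR (1 / 32) :> R.
  by apply: le_trans (expR_ge1Dx _); lra.
have h1 : expR (1 / 32) <= 32 / 31 :> R.
  have := @expR_ge1Dx R (- (1 / 32)); rewrite expRN => h.
  have x0 := @expR_gt0 R (1 / 32).
  rewrite -[leLHS]invrK -[leRHS]invrK lef_pV2 ?posrE ?invr_gt0 //; last lra.
  by apply: le_trans h; lra.
apply/andP; split.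
  rewrite E; apply: (@lo _ (16350 / 10000)); [lra| |lra].
  apply: (@lo _ (12787 / 10000)); [lra| |lra].
  apply: (@lo _ (11308 / 10000)); [lra| |lra].
  apply: (@lo _ (10634 / 10000)); [lra| |lra].
  by apply: (@lo _ (33 / 32)); [lra| |lra].
rewrite E; apply: (@up _ (16644 / 10000)); last lra.
apply: (@up _ (12901 / 10000)); last lra.
apply: (@up _ (11358 / 10000)); last lra.
apply: (@up _ (10657 / 10000)); last lra.
by apply: (@up _ (32 / 31)); last lra.
Qed.

Lemma expR2_bounds : 7 <= expR (2 : R) <= 8.
Proof.
have /andP[l u] := expR1_bounds.
by rewrite -[2]mulr1 expR_double; apply/andP; split; nra.
Qed.

Lemma expR4_gt : 99 / 2 < expR 4 :> R.
Proof.
have /andP[l u] := expR1_bounds.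
have l2 : 707 / 100 <= expR 2 :> R by rewrite -[2]mulr1 expR_double; nra.
by rewrite (_ : 4 = 2 * 2) ?expR_double; [nra|lra].
Qed.

Lemma expR3_lt : expR 3 < 22 :> R.
Proof.
have /andP[l u] := expR1_bounds.
have h2 : expR 2 <= 784 / 100 :> R by rewrite -[2]mulr1 expR_double; nra.
have -> : expR 3 = expR 2 * expR 1 :> R by rewrite -expRD; congr expR; lra.
nra.
Qed.

Lemma lt_expR_of_ln (a b : R) : ln a < b -> a < expR b.
Proof.
have [a0|a0] := leP a 0; first by move=> _; apply: le_lt_trans a0 (expR_gt0 _).
by rewrite -{2}(lnK a0) ltr_expR.
Qed.

(** For [k <= 26] the bound [expR 2 >= 7] would give [3 * 7 <= 8]. *)
Lemma expR_nat_ge k : 3 * expR 28 <= 8 * expR k%:R :> R -> (27 <= k)%N.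
Proof.
move=> h; rewrite leqNgt; apply/negP => k27.
have k26 : expR k%:R <= expR 26 :> R by rewrite ler_expR (ler_nat _ k 26).
have /andP[l _] := expR2_bounds; have x0 := @expR_gt0 R 26.
have p7 : 7 * expR 26 <= expR 2 * expR 26 :> R by rewrite ler_pM2r.
have E : expR 28 = expR 2 * expR 26 :> R by rewrite -expRD; congr expR; lra.
by move: h; rewrite E; lra.
Qed.

(** [N] is below a tower of [j] exponentials, [e], [e^e] or [e^(e^e)], whose exponents are below 6,
    14 and 22. *)
Lemma iter_ln_small (j : nat) (N : R) : (0 < j <= 3)%N ->
  iter j (@ln R) N < 1 -> N < expR (8 * j%:R - 2).
Proof.
have e3 := expR3_lt; have /andP[_ e1] := expR1_bounds.
case: j => [//|[|[|[|//]]]] _ /= /lt_expR_of_ln h.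
- by apply: lt_trans h _; rewrite ltr_expR; lra.
- have {}h := lt_expR_of_ln h.
  by apply: lt_trans h _; rewrite ltr_expR; lra.
- have {}h := lt_expR_of_ln (lt_expR_of_ln h).
  apply: lt_trans h _; rewrite ltr_expR.
  apply: (@le_lt_trans _ _ (expR 3)); last lra.
  by rewrite ler_expR; lra.
Qed.

Lemma exp8_le_exp10 r : (10 <= r)%N -> 8 * 8 ^+ r <= 10 ^+ r :> R.
Proof.
elim: r => [//|r IHr]; rewrite leq_eqVlt => /orP[/eqP <-|rr].
  have p2 : (8 * 8 : R) = 64 by lra.
  by rewrite !exprS !expr0; lra.
have := IHr rr; rewrite !exprS => h.
have h8 : 0 <= 8 ^+ r :> R by apply: exprn_ge0.
lra.
Qed.

End ExpBounds.

(** * Shrinking a set and iterating along [sigma] *)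

Section Step.
Variables (R : realType) (T : finType) (e : rel T).
Hypotheses (e_sym : symmetric e) (e_irr : irreflexive e).

(** Otherwise all subsets of [X] with at most [8 * k] vertices are dense, and [bfs_dense] bounds the
    ratio of [X] by [99 / 2 * y < expR 4 * y]. *)
Lemma shrink (k : nat) (y : R) (X : {set T}) :
  ~ has_cycle e k -> 0 < y -> (27 <= k)%N -> X != finset.set0 ->
  #|X|%:R <= 8 * expR k%:R :> R ->
  expR 4 * y * (alpha e X)%:R <= #|X|%:R ->
  exists Y : {set T}, [/\ Y != finset.set0, (#|Y| <= 8 * k)%N &
    y * (alpha e Y)%:R <= #|Y|%:R].
Proof.
move=> noC y0 k27 X0 Xk aX; apply: contrapT => H.
have small (Y : {set T}) : Y \subset X -> (#|Y| <= 8 * k)%N ->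
  alpha_dense e y Y.
  move=> _ Yk; rewrite /alpha_dense.
  have [->|Y0] := eqVneq Y finset.set0; first by rewrite cards0 mulr_ge0 // ltW.
  by rewrite leNgt; apply/negP => /ltW h; apply: H; exists Y.
(* The largest depth with [r.*2 < k]; then [8 * expR k <= 8 * 8 ^ r.+1 <= 10 ^ r.+1]. *)
pose r := (k.-1)./2.
have kr : (r.*2 < k)%N by rewrite /r; have := odd_double_half k.-1; lia.
have kr' : (k <= 2 * r.+1)%N by rewrite /r; have := odd_double_half k.-1; lia.
have Xr : (#|X| <= 10 ^ r.+1)%N.
  rewrite -(ler_nat R) natrX; apply: le_trans Xk _.
  apply: le_trans (@exp8_le_exp10 R r.+1 _); last lia.
  rewrite ler_wpM2l //; apply: (@le_trans _ _ (expR 2 ^+ r.+1)).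
    by rewrite -expRM_natl ler_expR -natrM mulnC ler_nat.
  by apply: lerXn2r; rewrite ?nnegrE ?expR_ge0 //;
  have /andP[] := expR2_bounds R.
have := bfs_dense e_sym noC (ltW y0) kr small Xr.
have a0 : 0 < (alpha e X)%:R :> R by rewrite ltr0n alpha_gt0.
have ya : 0 < y * (alpha e X)%:R by apply: mulr_gt0.
have := expR4_gt R; move: aX; rewrite -mulrA; nra.
Qed.

(** There are finitely many ratios, so failure for every [X] puts their maximum, and hence the
    supremum, below [c]. *)
Lemma iota_witness (c : R) : 0 < c -> c <= iota_ratio e R ->
  exists2 X : {set T}, X != finset.set0 & c * (alpha e X)%:R <= #|X|%:R.
Proof.
move=> c0 cle; apply: contrapT => H.
pose ratio (X : {set T}) : R := #|X|%:R / (alpha e X)%:R.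
have lt X : X != finset.set0 -> ratio X < c.
  move=> X0; have a0 : 0 < (alpha e X)%:R :> R by rewrite ltr0n alpha_gt0.
  rewrite /ratio ltr_pdivrMr // ltNge; apply/negP => h.
  by apply: H; exists X.
pose m := \big[Num.max/0]_(X : {set T} | X != finset.set0) ratio X.
have mc : m < c by apply: bigmax_lt => // X; apply: lt.
suff : iota_ratio e R <= m by rewrite leNgt (lt_le_trans mc cle).
rewrite /iota_ratio; set S := [set _ | _]%classic.
have Sm : ubound S m.
  by move=> r [X X0 ->]; rewrite /m (bigD1 X) //= le_max lexx.
(* Without vertices the set of ratios is empty and [sup] takes its default value 0. *)
have [->|/set0P S0] := eqVneq S classical_sets.set0.
  by rewrite sup0; apply: bigmax_ge_id.
exact: ge_sup.
Qed.

Variable sigma : nat -> nat.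
Hypotheses (sigma_incr : forall r s, (1 <= r)%N -> (r < s)%N ->
  (sigma r < sigma s)%N).
Hypothesis sigma1 : (3 <= sigma 1)%N.
Hypothesis sigma_log : forall r, (2 <= r)%N ->
  ln ((sigma r)%:R : R) <= (sigma r.-1)%:R.
Hypothesis no_cycle : forall r, (1 <= r)%N -> ~ has_cycle e (sigma r).

Lemma sigma_ge r : (1 <= r)%N -> (r <= sigma r)%N.
Proof.
elim: r => [//|[|r] IHr] _; first by apply: leq_trans sigma1.
by apply: leq_ltn_trans (sigma_incr (r := r.+1) _ _) => //; apply: IHr.
Qed.

(** Induction on [j], replacing [N] by [ln N]; the factor 8 before [N] absorbs the size [8 * k] of
    the sets given by [shrink]. *)
Lemma no_large_iota (j : nat) (N : R) (X : {set T}) :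
  (0 < j)%N -> iter j (@ln R) N < 1 -> X != finset.set0 -> #|X|%:R <= 8 * N ->
  (sigma 1)%:R * expR (8 * j%:R) * (alpha e X)%:R <= #|X|%:R :> R -> False.
Proof.
have s3 : 3 <= (sigma 1)%:R :> R by rewrite (ler_nat _ 3).
have /andP[e2l e2u] := expR2_bounds R.
have alpha1 (Y : {set T}) : Y != finset.set0 -> 1 <= (alpha e Y)%:R :> R.
  by move=> Y0; rewrite (ler_nat _ 1) alpha_gt0.
elim: j N X => [//|j IHj] N X _ itN X0 XN aX.
have X3 : 3 * expR (8 * j.+1%:R) <= #|X|%:R :> R.
  apply: le_trans aX; have E0 := expR_gt0 (8 * j.+1%:R : R).
  apply: (@le_trans _ _ ((sigma 1)%:R * expR (8 * j.+1%:R))).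
    by rewrite ler_wpM2r // ltW.
  by rewrite ler_peMr ?alpha1 // mulr_ge0 // ltW.
(* For [j.+1 <= 3] the bounds [3 * expR (8 * j.+1)] and [8 * expR (8 * j.+1 - 2)] on [#|X|] clash,
   as [3 * expR 2 > 8]. From 4 on, the sets stay large enough to force lengths of at least 27. *)
have [j3|j4] := leqP j.+1 3.
  have := iter_ln_small (j := j.+1) j3 itN.
  have := expR_gt0 (8 * j.+1%:R - 2 : R).
  have : expR (8 * j.+1%:R) = expR 2 * expR (8 * j.+1%:R - 2) :> R.
    by rewrite -expRD; congr expR; lra.
  nra.
have jR : 4 <= j.+1%:R :> R by rewrite (ler_nat _ 4).
have e32 : expR 32 <= expR (8 * j.+1%:R) :> R by rewrite ler_expR; lra.
have N0 : 0 < N by have := expR_gt0 (32 : R); lra.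
have ex_s : exists s, (1 <= s)%N && (ln N <= (sigma s)%:R).
  exists (Num.truncn (ln N)).+1; rewrite ltnS leq0n /=; apply: ltW.
  apply: lt_le_trans (truncnS_gt _) _.
  by rewrite ler_nat sigma_ge.
case: (ex_minnP ex_s) => s /andP[s1 Ns] mins.
have Xs : #|X|%:R <= 8 * expR (sigma s)%:R :> R.
  by apply: le_trans XN _; rewrite ler_wpM2l // -[leLHS](lnK N0) ler_expR.
have ks : (27 <= sigma s)%N.
  apply: (@expR_nat_ge R); apply: le_trans Xs; apply: le_trans X3.
  by rewrite ler_wpM2l // ler_expR; lra.
pose y1 : R := (sigma 1)%:R * expR (8 * j.+1%:R - 4).
have y1_gt0 : 0 < y1 by apply: mulr_gt0; [lra|apply: expR_gt0].
have [|Y [Y0 Yk aY]] := shrink (no_cycle s1) y1_gt0 ks X0 Xs.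
  apply: le_trans aX; rewrite /y1 mulrCA -expRD.
  by rewrite (_ : 4 + _ = 8 * j.+1%:R :> R) //; lra.
have Y28 : (sigma 1)%:R * expR 28 <= #|Y|%:R :> R.
  apply: le_trans aY.
  have : expR 28 <= expR (8 * j.+1%:R - 4) :> R by rewrite ler_expR; lra.
  have := alpha1 Y Y0; rewrite /y1 => a1 e28.
  have p1 : (sigma 1)%:R * expR 28 <= y1 by rewrite /y1 ler_wpM2l.
  rewrite /y1 in p1 y1_gt0; nra.
have {}Yk : #|Y|%:R <= 8 * (sigma s)%:R :> R by rewrite -natrM ler_nat.
(* For [s = 1], [#|Y| <= 8 * sigma 1] contradicts [#|Y| >= sigma 1 * expR 28]. *)
case: s s1 Ns mins Xs ks Yk => [//|[|s]] _ Ns mins Xs ks Yk.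
  have : (sigma 1)%:R * (1 + 28) <= (sigma 1)%:R * expR 28 :> R.
    by rewrite ler_wpM2l ?expR_ge1Dx.
  lra.
have sN : (sigma s.+1)%:R < ln N.
  by rewrite ltNge; apply/negP => h; have := mins s.+1 h; rewrite ltnn.
(* By the growth condition on [sigma], [Y] is small enough to apply [shrink] again with the previous
   length, which is below [ln N]. *)
have Ys : #|Y|%:R <= 8 * expR (sigma s.+1)%:R :> R.
  apply: le_trans Yk _; rewrite ler_wpM2l //.
  have sp : 0 < (sigma s.+2)%:R :> R.
    by rewrite ltr0n; apply: leq_trans (sigma_ge (ltn0Sn _)).
  by rewrite -[leLHS](lnK sp) ler_expR; apply: sigma_log.
have ks' : (27 <= sigma s.+1)%N.
  apply: (@expR_nat_ge R); apply: le_trans Ys; apply: le_trans Y28.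
  by rewrite ler_wpM2r // expR_ge0.
pose y2 : R := (sigma 1)%:R * expR (8 * j%:R).
have y2_gt0 : 0 < y2 by apply: mulr_gt0; [lra|apply: expR_gt0].
have [|Z [Z0 Zk aZ]] := shrink (no_cycle (ltn0Sn s)) y2_gt0 ks' Y0 Ys.
  apply: le_trans aY; rewrite /y1 /y2 mulrCA -expRD.
  by rewrite (_ : 4 + _ = 8 * j.+1%:R - 4 :> R) // -[j.+1]addn1 natrD; lra.
apply: (IHj (ln N) Z) => //; first by rewrite -ltnS (ltn_trans _ j4).
  by rewrite -iterSr.
apply: (@le_trans _ _ (8 * (sigma s.+1)%:R)); first by rewrite -natrM ler_nat.
by rewrite ler_wpM2l // ltW.
Qed.

End Step.

Theorem theorem4 (R : realType) (sigma : nat -> nat)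
    (sigma_pos : forall r : nat, (1 <= r)%N -> (0 < sigma r)%N)
    (sigma_incr : forall r s : nat,
       (1 <= r)%N -> (r < s)%N -> (sigma r < sigma s)%N)
    (sigma1 : (3 <= sigma 1)%N)
    (sigma_log : forall r : nat,
       (2 <= r)%N -> ln ((sigma r)%:R : R) <= (sigma r.-1)%:R)
    (T : finType) (e : rel T) (e_sym : symmetric e) (e_irr : irreflexive e)
    (n : nat) (cardT : #|T| = n)
    (iota_large :
       (sigma 1%N)%:R * expR (8%:R * (log_star (n%:R : R))%:R)
         <= iota_ratio e R) :
  exists2 r : nat, (1 <= r)%N & has_cycle e (sigma r).
Proof.
apply: contrapT => H.
have no_cycle r : (1 <= r)%N -> ~ has_cycle e (sigma r).
  by move=> r1 hc; apply: H; exists r.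
move: iota_large; rewrite /log_star; case: ex_minnP => j jn _ iota_large.
have [|X X0 aX] := iota_witness e_irr _ iota_large.
  by apply: mulr_gt0; [rewrite ltr0n; lia|apply: expR_gt0].
have Xn : (#|X| <= n)%N by rewrite -cardT max_card.
have X1 : (0 < #|X|)%N by rewrite card_gt0.
have XR : #|X|%:R <= n%:R :> R by rewrite ler_nat.
have XR1 : 1 <= #|X|%:R :> R by rewrite (ler_nat _ 1).
apply: (no_large_iota e_sym e_irr sigma_incr sigma1 sigma_log no_cycle _ jn X0 _ aX).
(* [j = 0] would mean [n < 1], but [X] is nonempty. *)
- by case: j jn {iota_large aX} => //= ; lra.
- lra.
Qed.
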